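(* Let $I=\langle T_0^{d_1},T_0^{u_1}T_1^{u_2},T_1^{d_2}\rangle\subseteq\mathbb{K}[T_0,T_1]$ be a monomial ideal in two variables minimally generated by these three monomials (so $0<u_1<d_1$, $0<u_2<d_2$), and let $q=\min\{d_1/\gcd(d_1,u_1),\,d_2/\gcd(d_2,u_2)\}$. Then the algorithm described in the context terminates in at most $q$ steps (i.e. it stops at some step $j\le q$) and returns the minimal generating set (unique up to signs of its elements) of the Rees ideal $\mathcal{R}(I)$ of $I$.
   Context: $\mathbb{K}$ is a field, $S=\mathbb{K}[T_0,T_1,X_0,X_1,X_2]$. The Rees ideal $\mathcal{R}(I)$ is the kernel of the $\mathbb{K}[T_0,T_1]$-algebra map $\phi:S\to\mathbb{K}[T_0,T_1][z]$, $X_0\mapsto T_0^{d_1}z$, $X_1\mapsto T_0^{u_1}T_1^{u_2}z$, $X_2\mapsto T_1^{d_2}z$. For $k\in\{1,2\}$ and $j\ge1$: $a^{(k)}_j=u_kj \bmod d_k\in\{0,\dots,d_k-1\}$ and $b^{(k)}_j=\lfloor u_kj/d_k\rfloor$. Algorithm. Input $d_1,d_2,u_1,u_2$. Step $j=1$: put $T_1^{u_2}X_0-T_0^{d_1-u_1}X_1$ and $T_1^{d_2-u_2}X_1-T_0^{u_1}X_2$ into the output set, and set $\max^{(k)}=\min^{(k)}=u_k$ for $k=1,2$. Then for $j=2,3,\dots$, in order: (i) if $b^{(1)}_j-b^{(1)}_{j-1}=b^{(2)}_j-b^{(2)}_{j-1}=0$, add $T_0^{d_1-a^{(1)}_j}T_1^{d_2-a^{(2)}_j}X_1^j-X_0^{b^{(1)}_j+1}X_2^{b^{(2)}_j+1}$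 to the output and stop; (ii) if $b^{(1)}_j-b^{(1)}_{j-1}=b^{(2)}_j-b^{(2)}_{j-1}=1$, add $T_0^{a^{(1)}_j}T_1^{a^{(2)}_j}X_0^{b^{(1)}_j}X_2^{b^{(2)}_j}-X_1^j$ to the output and stop; (iii) otherwise: if $a^{(1)}_j>\max^{(1)}$ and $a^{(2)}_j<\min^{(2)}$, add $T_1^{a^{(2)}_j}X_0^{b^{(1)}_j+1}X_2^{b^{(2)}_j}-T_0^{d_1-a^{(1)}_j}X_1^j$ and set $\max^{(1)}=a^{(1)}_j$, $\min^{(2)}=a^{(2)}_j$; if $a^{(1)}_j<\min^{(1)}$ and $a^{(2)}_j>\max^{(2)}$, add $T_1^{d_2-a^{(2)}_j}X_1^j-T_0^{a^{(1)}_j}X_0^{b^{(1)}_j}X_2^{b^{(2)}_j+1}$ and set $\min^{(1)}=a^{(1)}_j$, $\max^{(2)}=a^{(2)}_j$; then stop if $a^{(1)}_j=0$ or $a^{(2)}_j=0$. The minimal generating set of $\mathcal{R}(I)$ is understood as a minimal generating set consisting of binomials with coefficients $\pm1$, considered up to sign changes of its elements. *)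

(* Defs.v *)
From HB Require Import structures.
From mathcomp Require Import all_boot all_order all_algebra.
From mathcomp Require Import mpoly.

Set Implicit Arguments.
Unset Strict Implicit.
Unset Printing Implicit Defensive.

Import GRing.Theory.
Local Open Scope ring_scope.

Section Ideals.
Variable R : comNzRingType.
Implicit Types A B J : R -> Prop.

Definition ideal_of A : R -> Prop := fun p =>
  exists (n : nat) (c g : 'I_n -> R),
    (forall i, A (g i)) /\ p = \sum_(i < n) c i * g i.

Definition generates A J : Prop := forall p, J p <-> ideal_of A p.

Definition minimal_generating_set A J : Prop :=
  generates A J /\
  forall B, (forall p, B p -> A p) -> generates B J -> forall p, A p -> B p.

Definition equal_up_to_signs A B : Prop :=
  forall p, (A p \/ A (- p)) <-> (B p \/ B (- p)).

Definition in_seq (s : seq R) : R -> Prop := fun p => p \in s.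

End Ideals.

Section Rees.
Variables (K : fieldType) (d1 d2 u1 u2 : nat).

Definition I_gens : seq {mpoly K[2]} :=
  let t0 : {mpoly K[2]} := 'X_(@Ordinal 2 0 isT) in
  let t1 : {mpoly K[2]} := 'X_(@Ordinal 2 1 isT) in
  [:: t0 ^+ d1; t0 ^+ u1 * t1 ^+ u2; t1 ^+ d2].

Definition I_ideal : {mpoly K[2]} -> Prop := ideal_of (in_seq I_gens).

(* The variables T_0, T_1, X_0, X_1, X_2 of S have indices 0, ..., 4. *)
Definition T0 : {mpoly K[5]} := 'X_(@Ordinal 5 0 isT).
Definition T1 : {mpoly K[5]} := 'X_(@Ordinal 5 1 isT).
Definition X0 : {mpoly K[5]} := 'X_(@Ordinal 5 2 isT).
Definition X1 : {mpoly K[5]} := 'X_(@Ordinal 5 3 isT).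
Definition X2 : {mpoly K[5]} := 'X_(@Ordinal 5 4 isT).

(* Here 'X is the variable z of K[T_0, T_1][z]. *)
Definition phi_vars (i : 'I_5) : {poly {mpoly K[2]}} :=
  nth 0 [:: ('X_(@Ordinal 2 0 isT) : {mpoly K[2]})%:P;
            ('X_(@Ordinal 2 1 isT) : {mpoly K[2]})%:P;
            (nth 0 I_gens 0)%:P * 'X;
            (nth 0 I_gens 1)%:P * 'X;
            (nth 0 I_gens 2)%:P * 'X] i.

Definition phi (p : {mpoly K[5]}) : {poly {mpoly K[2]}} :=
  mmap (fun c : K => (c%:MP_[2])%:P) phi_vars p.

Definition rees_ideal : {mpoly K[5]} -> Prop := fun p => phi p = 0.

Definition pm_binomial (p : {mpoly K[5]}) : Prop :=
  exists (s s' : bool) (m m' : 'X_{1..5}),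
    m != m' /\ p = (-1) ^+ s *: 'X_[m] + (-1) ^+ s' *: 'X_[m'].

Definition minimal_binomial_generating_set (A J : {mpoly K[5]} -> Prop) : Prop :=
  minimal_generating_set A J /\ forall p, A p -> pm_binomial p.

Record state := State {
  max1 : nat; min1 : nat; max2 : nat; min2 : nat;
  output : seq {mpoly K[5]};
  stopped : bool
}.

Definition a1 (j : nat) : nat := (u1 * j %% d1)%N.
Definition a2 (j : nat) : nat := (u2 * j %% d2)%N.
Definition b1 (j : nat) : nat := (u1 * j %/ d1)%N.
Definition b2 (j : nat) : nat := (u2 * j %/ d2)%N.

Definition initial : state :=
  State u1 u1 u2 u2
    [:: T1 ^+ u2 * X0 - T0 ^+ (d1 - u1) * X1;
        T1 ^+ (d2 - u2) * X1 - T0 ^+ u1 * X2]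
    false.

Definition add_stop (f : {mpoly K[5]}) (st : state) : state :=
  State (max1 st) (min1 st) (max2 st) (min2 st) (f :: output st) true.

Definition stop_if (c : bool) (st : state) : state :=
  State (max1 st) (min1 st) (max2 st) (min2 st) (output st) c.

Definition update1 (j : nat) (st : state) : state :=
  if (max1 st < a1 j)%N && (a2 j < min2 st)%N then
    State (a1 j) (min1 st) (max2 st) (a2 j)
      (T1 ^+ a2 j * X0 ^+ (b1 j).+1 * X2 ^+ b2 j
         - T0 ^+ (d1 - a1 j) * X1 ^+ j :: output st)
      (stopped st)
  else st.

Definition update2 (j : nat) (st : state) : state :=
  if (a1 j < min1 st)%N && (max2 st < a2 j)%N then
    State (max1 st) (a1 j) (a2 j) (min2 st)
      (T1 ^+ (d2 - a2 j) * X1 ^+ j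
         - T0 ^+ a1 j * X0 ^+ b1 j * X2 ^+ (b2 j).+1 :: output st)
      (stopped st)
  else st.

(* The truncated differences below are exact, since b1 and b2 are nondecreasing. *)
Definition step (j : nat) (st : state) : state :=
  if stopped st then st
  else if (b1 j - b1 j.-1 == 0)%N && (b2 j - b2 j.-1 == 0)%N then
    add_stop (T0 ^+ (d1 - a1 j) * T1 ^+ (d2 - a2 j) * X1 ^+ j
                - X0 ^+ (b1 j).+1 * X2 ^+ (b2 j).+1) st
  else if (b1 j - b1 j.-1 == 1)%N && (b2 j - b2 j.-1 == 1)%N then
    add_stop (T0 ^+ a1 j * T1 ^+ a2 j * X0 ^+ b1 j * X2 ^+ b2 j - X1 ^+ j) st
  else
    stop_if ((a1 j == 0)%N || (a2 j == 0)%N) (update2 j (update1 j st)).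

(* The state after step j, for j >= 1; it no longer changes once stopped. *)
Definition run (j : nat) : state :=
  foldl (fun st i => step i st) initial (iota 2 j.-1).

End Rees.

Arguments I_ideal : clear implicits.
Arguments rees_ideal : clear implicits.

(* Main.v *)
Require Import Defs.
From mathcomp Require Import all_boot all_order all_algebra.
From mathcomp Require Import mpoly zify ring.
Set Implicit Arguments.
Unset Strict Implicit.
Unset Printing Implicit Defensive.

Import GRing.Theory.

(**
Since [phi] sends every monomial to a monomial, the Rees ideal is spanned by
the differences of monomials lying in a common fibre, that is, with the same
image.  All the generators concerned have the following form: for p + q = j,
the monomials X1^j and X0^p X2^q, completed by the least powers of T0 and T1
that give them the same image ([powX1], [prodX]).  So the output of the
algorithm is encoded by a list of pairs (p, q), and the sign that the algorithm
gives to each binomial is a function of the pair ([pair_binomial]).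

Write u_k j = d_k b_k(j) + a_k(j).  As long as the algorithm runs, exactly one
of b_1, b_2 increases at each step, so b_1(k) + b_2(k) + 1 = k and both
residues are positive ([regular]).  Comparing this equation at i, at j - i and
at j shows that exactly one of the additions of residues carries; hence the
sequences a_1 and a_2 are ordered in opposite ways ([res_antitone]), and a new
minimum of one is a new maximum of the other.  This is why the tests of the
algorithm detect exactly the new maxima of a_1 and of a_2.

Minimality and uniqueness.  For each output pair the two monomials are coprime
and are the only elements of their fibre ([indispensable_record],
[indispensable_ceil], [indispensable_floor]).  When such a binomial is written
as a combination of elements of a binomial generating set H, some element of H
times a monomial must involve the first of the two monomials, hence joins it
to another element of the fibre, so to the second one; by coprimality that
element of H is the binomial itself up to sign ([indispensable_generator]).

Generation.  By induction on the weight of the fibre, it is enough to replace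
one of two given monomials, by means of one output binomial, so that the result
shares a variable with the other ([congruent_step]).  The only case that is not
immediate is a pair X1^e, X0^c X2^f with e = c + f, up to powers of T0 and T1.
The lemma [exchange] finds there a suitable output pair: for e below the
stopping index N it is the record among the first e residues, and from N on it
is the last pair or one of the two initial ones.

Termination.  At j = d_k / gcd(d_k, u_k) the residue a_k(j) vanishes, which
regularity forbids, so the algorithm has stopped by then ([run_finishes]).
*)

(** * Carries in the sequences of quotients and residues *)

Definition quo u d j := u * j %/ d.
Definition res u d j := u * j %% d.

Section OneRatio.
Variables (u d : nat).
Hypothesis d_gt0 : 0 < d.

Lemma quo_res j : u * j = d * quo u d j + res u d j.
Proof. by rewrite mulnC [d * _]mulnC -divn_eq mulnC. Qed.

Lemma res_lt j : res u d j < d.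
Proof. exact: ltn_pmod. Qed.

Lemma leq_quo c j : (c <= quo u d j) = (d * c <= u * j).
Proof. by rewrite /quo leq_divRL // [c * _]mulnC. Qed.

Lemma quo_ltn c j : (quo u d j < c) = (u * j < d * c).
Proof. by rewrite /quo ltn_divLR // [c * _]mulnC. Qed.

Lemma quoD i k :
  quo u d (i + k) = quo u d i + quo u d k + (d <= res u d i + res u d k).
Proof. by rewrite /quo mulnDr divnD. Qed.

Lemma resD i k : res u d (i + k) + d * (d <= res u d i + res u d k)
  = res u d i + res u d k.
Proof.
have := quo_res i; have := quo_res k; have := quo_res (i + k).
by rewrite quoD mulnDr !mulnDr; lia.
Qed.

End OneRatio.

(** What holds of the indices k < N when no step before N has stopped the
algorithm: exactly one of the two quotients has increased at each of
the steps 2, ..., N - 1. *)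
Definition regular u1 d1 u2 d2 N := forall k, 0 < k < N ->
  [/\ 0 < res u1 d1 k, 0 < res u2 d2 k & (quo u1 d1 k + quo u2 d2 k).+1 = k].

(** The triples (c, e, f) are the exponents of X0, X1, X2 in the monomials of
the fibre of [powX1]; the exponents of T0 and T1 are determined by them, and
the two inequalities say that these are nonnegative. *)
Definition indispensable u1 d1 u2 d2 p q := 0 < p + q /\
  forall c e f, c + e + f = p + q ->
  d1 * c + u1 * e <= maxn (d1 * p) (u1 * (p + q)) ->
  d2 * f + u2 * e <= maxn (d2 * q) (u2 * (p + q)) ->
  [/\ c = 0, e = p + q & f = 0] \/ [/\ c = p, e = 0 & f = q].

Lemma regular_sym u1 d1 u2 d2 N :
  regular u1 d1 u2 d2 N -> regular u2 d2 u1 d1 N.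
Proof. by move=> reg k /reg[? ? ?]; split=> //; lia. Qed.

Lemma indispensable_sym u1 d1 u2 d2 p q :
  indispensable u1 d1 u2 d2 p q -> indispensable u2 d2 u1 d1 q p.
Proof.
move=> [pq0 ind]; split=> [|c e f]; first by rewrite addnC.
rewrite ![q + p]addnC => ce h2 h1.
by case: (ind f e c _ h1 h2) => [|[-> -> ->]|[-> -> ->]]; [lia|left|right].
Qed.

Section TwoRatios.
Variables (u1 d1 u2 d2 : nat).
Hypotheses (u1_gt0 : 0 < u1) (u1_lt : u1 < d1) (u2_gt0 : 0 < u2) (u2_lt : u2 < d2).

Let d1_gt0 : 0 < d1. Proof. lia. Qed.
Let d2_gt0 : 0 < d2. Proof. lia. Qed.

Local Notation b1 := (quo u1 d1).
Local Notation b2 := (quo u2 d2).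
Local Notation a1 := (res u1 d1).
Local Notation a2 := (res u2 d2).

(** Adding the residues at i and at j - i carries in exactly one of the two
coordinates, because the defect b_1 + b_2 + 1 = k holds at i, j - i and j. In the
coordinate with a carry the residue decreases from i to j, in the other one it
increases. *)
Lemma res_antitone j i : regular u1 d1 u2 d2 j -> (b1 j + b2 j).+1 = j ->
  0 < i < j -> (a1 i < a1 j /\ a2 j < a2 i) \/ (a1 j < a1 i /\ a2 i < a2 j).
Proof.
move=> reg bj /andP[i0 ij].
have ik : j = i + (j - i) by lia.
have [|r1 r2 rb] := reg i; first lia.
have [|s1 s2 sb] := reg (j - i); first lia.
have := quoD u1 d1_gt0 i (j - i); have := quoD u2 d2_gt0 i (j - i).
have := resD u1 d1_gt0 i (j - i); have := resD u2 d2_gt0 i (j - i).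
have := res_lt u1 d1_gt0 (j - i); have := res_lt u2 d2_gt0 (j - i).
rewrite -ik; case: (d1 <= _); case: (d2 <= _) => /=; lia.
Qed.

(** In another monomial of the fibre, with X1^e and 0 < e < j, the exponents of
X0 and X2 could only reach the sum j - e if the second residues at e and
at j - e carried, and then a_2(e) would exceed the record a_2(j). *)
Lemma indispensable_record j : 0 < j -> regular u1 d1 u2 d2 j ->
  (b1 j + b2 j).+1 = j -> (forall i, 0 < i < j -> a2 i < a2 j) ->
  indispensable u1 d1 u2 d2 (b1 j) (b2 j).+1.
Proof.
move=> j0 reg bj rec; rewrite /indispensable addnS bj; split=> // c e f cef.
have r1 := quo_res u1 d1 j; have r2 := quo_res u2 d2 j.
have l2 := res_lt u2 d2_gt0 j.
rewrite (maxn_idPr _) ?(maxn_idPl _) => [||]; [|nia|nia] => h1 h2.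
have [ej|je] := leqP e j; last by nia.
have cq : c <= b1 (j - e) by rewrite leq_quo //; nia.
have [e0|e0] := posnP e.
  move: cq h2; rewrite e0 subn0 muln0 addn0 leq_pmul2l // => cq h2.
  right; split=> //; lia.
have [ej'|je] := ltnP e j; last by left; split; lia.
have [|r3 r4 rb] := reg e; first lia.
have [|s1 s2 sb] := reg (j - e); first lia.
have fq : f + b2 e <= b2 j.
  have := quo_res u2 d2 e => r5; rewrite -ltnS -(ltn_pmul2l d2_gt0); lia.
have ik : j = e + (j - e) by lia.
have := quoD u2 d2_gt0 e (j - e); have := resD u2 d2_gt0 e (j - e).
have := res_lt u2 d2_gt0 (j - e); have := rec e; rewrite -ik.
by case: (d2 <= _) => /=; lia.
Qed.

(** For 0 < e < j regularity at e alone bounds the exponents of X0 and X2 by a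
sum less than j - e. *)
Lemma indispensable_ceil j : 0 < j -> regular u1 d1 u2 d2 j ->
  0 < a1 j -> 0 < a2 j ->
  (b1 j + b2 j).+2 = j -> indispensable u1 d1 u2 d2 (b1 j).+1 (b2 j).+1.
Proof.
move=> j0 reg aj1 aj2 bj; rewrite /indispensable addnS addSn bj; split=> // c e f cef.
have r1 := quo_res u1 d1 j; have r2 := quo_res u2 d2 j.
have l1 := res_lt u1 d1_gt0 j; have l2 := res_lt u2 d2_gt0 j.
rewrite !(maxn_idPl _) => [||]; [|nia|nia] => h1 h2.
have [ej|je] := leqP e j; last by nia.
have [e0|e0] := posnP e.
  move: h1 h2; rewrite e0 !muln0 !addn0 !leq_pmul2l // => h1 h2.
  right; split=> //; lia.
have [ej'|je] := ltnP e j; last by left; split; lia.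
have [|r3 r4 rb] := reg e; first lia.
have r5 := quo_res u1 d1 e; have r6 := quo_res u2 d2 e.
have: c + b1 e < (b1 j).+1 by rewrite -(ltn_pmul2l d1_gt0); lia.
have: f + b2 e < (b2 j).+1 by rewrite -(ltn_pmul2l d2_gt0); lia.
lia.
Qed.

(** Here it is regularity at j - e that bounds the sum of the exponents of X0 and
X2 by j - e - 1. *)
Lemma indispensable_floor j : 0 < j -> regular u1 d1 u2 d2 j ->
  b1 j + b2 j = j -> indispensable u1 d1 u2 d2 (b1 j) (b2 j).
Proof.
move=> j0 reg bj; rewrite /indispensable bj; split=> // c e f cef.
have r1 := quo_res u1 d1 j; have r2 := quo_res u2 d2 j.
rewrite !(maxn_idPr _) => [||]; [|nia|nia] => h1 h2.
have [ej|je] := leqP e j; last by nia.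
have cq : c <= b1 (j - e) by rewrite leq_quo //; nia.
have fq : f <= b2 (j - e) by rewrite leq_quo //; nia.
have [e0|e0] := posnP e.
  by move: cq fq; rewrite e0 subn0 => cq fq; right; split; lia.
have [ej'|je] := ltnP e j; last by left; split; lia.
have [|s1 s2 sb] := reg (j - e); lia.
Qed.

End TwoRatios.

(** * The exchange property of the output pairs *)

(** The index k is meant to be the one where a_2 is largest among 1, ..., e; the
same predicate with the roles of the indices 1 and 2 exchanged speaks of a_1. *)
Definition records_cover u1 d1 u2 d2 (P : nat -> nat -> Prop) N :=
  forall e, 0 < e < N -> exists k,
    [/\ 0 < k <= e, P (quo u1 d1 k) (quo u2 d2 k).+1
      & res u2 d2 e <= res u2 d2 k].

(** The first alternative is a stop where both quotients increase: then p and q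
are the floors of u_k N / d_k. In all the other stops they are the
ceilings; for the index whose residue vanishes the two agree. *)
Definition final_pair u1 d1 u2 d2 p q :=
  let N := p + q in
  [/\ 0 < p, 0 < q, d1 * p <= u1 * N & d2 * q <= u2 * N] \/
  [/\ u1 * N <= d1 * p, d1 * p < u1 * N + d1,
      u2 * N <= d2 * q & d2 * q < u2 * N + d2].

(** The properties of the set P of output pairs, and of the stopping index N,
from which it follows that the corresponding binomials generate. *)
Definition complete_pairs u1 d1 u2 d2 P N :=
  [/\ [/\ 0 < N, P 1 0 & P 0 1], regular u1 d1 u2 d2 N,
      records_cover u1 d1 u2 d2 P N, records_cover u2 d2 u1 d1 (fun q p => P p q) N
    & exists p q, [/\ P p q, p + q = N & final_pair u1 d1 u2 d2 p q]].

(** The first monomial of the pair (p, q) divides that of (c, f), and the second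
ones share X0 or X2. *)
Definition applies_left u1 d1 u2 d2 p q c f :=
  [/\ p + q <= c + f, d1 * p - u1 * (p + q) <= d1 * c - u1 * (c + f),
      d2 * q - u2 * (p + q) <= d2 * f - u2 * (c + f)
    & (0 < p) && (0 < c) || (0 < q) && (0 < f)].

(** The second monomial of the pair (p, q) divides that of (c, f); the first ones
then share X1. *)
Definition applies_right u1 d1 u2 d2 p q c f :=
  [/\ 0 < p + q, p <= c, q <= f,
      u1 * (p + q) - d1 * p <= u1 * (c + f) - d1 * c
    & u2 * (p + q) - d2 * q <= u2 * (c + f) - d2 * f].

Definition exchangeable u1 d1 u2 d2 P c f := exists p q, P p q /\
  (applies_left u1 d1 u2 d2 p q c f \/ applies_right u1 d1 u2 d2 p q c f).

Lemma complete_pairs_sym u1 d1 u2 d2 (P : nat -> nat -> Prop) N :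
  complete_pairs u1 d1 u2 d2 P N -> complete_pairs u2 d2 u1 d1 (fun q p => P p q) N.
Proof.
move=> [[N0 P10 P01] reg cov1 cov2 [p [q [Ppq pq fin]]]]; split=> //.
  exact: regular_sym.
exists q, p; split=> //; first by rewrite addnC.
by rewrite /final_pair [q + p]addnC; case: fin => -[? ? ? ?]; [left|right].
Qed.

Lemma exchangeable_sym u1 d1 u2 d2 (P : nat -> nat -> Prop) c f :
  exchangeable u2 d2 u1 d1 (fun q p => P p q) f c -> exchangeable u1 d1 u2 d2 P c f.
Proof.
move=> [q [p [Ppq ex]]]; exists p, q; split=> //.
case: ex => [[pq h2 h1 share]|[pq0 qf pc h2 h1]]; [left|right];
  by split; rewrite 1?[p + q]addnC 1?[c + f]addnC // orbC.
Qed.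

Section Exchange.
Variables (u1 d1 u2 d2 : nat).
Hypotheses (u1_gt0 : 0 < u1) (u1_lt : u1 < d1) (u2_gt0 : 0 < u2) (u2_lt : u2 < d2).
Variables (P : nat -> nat -> Prop) (N : nat).
Hypothesis P_complete : complete_pairs u1 d1 u2 d2 P N.

Let d1_gt0 : 0 < d1. Proof. lia. Qed.
Let d2_gt0 : 0 < d2. Proof. lia. Qed.

(** In this case the binomial of (c, f) has T0 with X0^c X2^f and T1 with X1^e.
For e < N the record of a_2 among the indices up to e applies to X1^e.  For
e >= N the last pair applies: to X1^e if it consists of floors; if it consists of
ceilings, to X0^c X2^f unless c is too small, and then f is so large that
T1^(d2 - u2) divides the first monomial. *)
Lemma exchange_mixed c f : 0 < c + f ->
  d1 * c <= u1 * (c + f) -> u2 * (c + f) <= d2 * f -> exchangeable u1 d1 u2 d2 P c f.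
Proof.
have [[N0 P10 P01] reg cov _ [p [q [Ppq pqN fin]]]] := P_complete.
move=> e0 h1 h2; have f0 : 0 < f by nia.
have [eN|Ne] := ltnP (c + f) N.
  have [|k [k0 Pk rk]] := cov (c + f); first lia.
  have [|r1 r2 rb] := reg (c + f); first lia.
  have [|s1 s2 sb] := reg k; first lia.
  exists (quo u1 d1 k), (quo u2 d2 k).+1; split=> //; left.
  have q1 := quo_res u1 d1 k; have q2 := quo_res u2 d2 k.
  have e2 := quo_res u2 d2 (c + f); have lk := res_lt u2 d2_gt0 k.
  have cq : c <= quo u1 d1 (c + f) by rewrite leq_quo.
  have fq : quo u2 d2 (c + f) < f by lia.
  rewrite /applies_left addnS sb f0 /= orbT; split=> //; first lia.
  - nia.
  - have: d2 * (quo u2 d2 (c + f)).+1 <= d2 * f by rewrite leq_pmul2l.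
    nia.
case: fin; rewrite /= pqN => -[p0 q0 hp hq]; rewrite -pqN in Ne.
  by exists p, q; split=> //; left; rewrite /applies_left pqN f0 q0 orbT; split=> //; lia.
have qf : q <= f.
  by rewrite -ltnS -(ltn_pmul2l d2_gt0); nia.
have [pc|cp] := leqP p c.
  by exists p, q; split=> //; right; rewrite /applies_right; split; nia.
(* Here c < p: the initial pair (0, 1) applies to X1^e. *)
exists 0, 1; split=> //; left; rewrite /applies_left f0 orbT; split=> //; first lia.
have: d2 * c.+1 <= d2 * p by rewrite leq_pmul2l.
have: (p + q) * (d2 - u2) <= (c + f) * (d2 - u2) by rewrite leq_mul2r Ne orbT.
by rewrite /= in hq *; nia.
Qed.

End Exchange.

(** When T0 and T1 are both on the same side of the binomial of (c, f), regularity
excludes e < N, and from N on the last pair applies. *)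
Lemma exchange u1 d1 u2 d2 (P : nat -> nat -> Prop) N c f :
  0 < u1 < d1 -> 0 < u2 < d2 -> complete_pairs u1 d1 u2 d2 P N ->
  0 < c + f -> exchangeable u1 d1 u2 d2 P c f.
Proof.
move=> /andP[u1_gt0 u1_lt] /andP[u2_gt0 u2_lt] compl e0.
have [d1_gt0 d2_gt0] : 0 < d1 /\ 0 < d2 by lia.
have [h1|h1] := leqP (d1 * c) (u1 * (c + f));
  have [h2|h2] := leqP (d2 * f) (u2 * (c + f)); last first.
- have [[N0 P10 P01] reg _ _ [p [q [Ppq pqN fin]]]] := compl.
  have [eN|Ne] := ltnP (c + f) N.
    have [|r1 r2 rb] := reg (c + f); first lia.
    have := quo_ltn u1 d1_gt0 c (c + f); have := quo_ltn u2 d2_gt0 f (c + f); lia.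
  exists p, q; split=> //.
  rewrite -pqN in Ne; case: fin => /= -[p0 q0 hp hq].
    by left; rewrite /applies_left; split; nia.
  have pc : p <= c by rewrite -ltnS -(ltn_pmul2l d1_gt0); nia.
  have qf : q <= f by rewrite -ltnS -(ltn_pmul2l d2_gt0); nia.
  by right; rewrite /applies_right; split; nia.
- apply: exchangeable_sym; apply: (exchange_mixed _ _ _ _ (complete_pairs_sym compl)) => //;
    rewrite 1?addnC //; exact: ltnW.
- by apply: (exchange_mixed _ _ _ _ compl) => //; apply: ltnW.
have [[N0 P10 P01] reg _ _ [p [q [Ppq pqN fin]]]] := compl.
have [eN|Ne] := ltnP (c + f) N.
  have [|r1 r2 rb] := reg (c + f); first lia.
  have := leq_quo u1 d1_gt0 c (c + f); have := leq_quo u2 d2_gt0 f (c + f); lia.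
exists p, q; split=> //.
rewrite -pqN in Ne; case: fin => /= -[p0 q0 hp hq].
  by left; rewrite /applies_left; split; nia.
(* The slopes satisfy c / e <= u1 / d1 <= p / N and f / e <= u2 / d2 <= q / N;
   both ends have sum 1, so all of these are equalities. *)
have hc : (p + q) * c <= (c + f) * p.
  by rewrite -(leq_pmul2l d1_gt0); nia.
have hf : (p + q) * f <= (c + f) * q.
  by rewrite -(leq_pmul2l d2_gt0); nia.
have pc : p <= c by rewrite -(@leq_pmul2l (p + q)); nia.
have qf : q <= f by rewrite -(@leq_pmul2l (p + q)); nia.
by right; rewrite /applies_right; split; nia.
Qed.

(** * Ideals generated by a set *)

Section IdealClosure.
Local Open Scope ring_scope.
Variable R : comNzRingType.
Implicit Types A B J : R -> Prop.

Lemma ideal_of_gen A g : A g -> ideal_of A g.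
Proof.
move=> Ag; exists 1%N, (fun=> 1), (fun=> g); split=> //.
by rewrite big_ord1 mul1r.
Qed.

Lemma ideal_of0 A : ideal_of A 0.
Proof.
exists 0%N, (fun=> 0), (fun=> 0); split=> [[] //|].
by rewrite big_ord0.
Qed.

Lemma ideal_ofD A p q : ideal_of A p -> ideal_of A q -> ideal_of A (p + q).
Proof.
move=> [m [c [g [Ag ->]]]] [n [c' [g' [Ag' ->]]]].
pose sel T (h : 'I_m -> T) (h' : 'I_n -> T) i :=
  match split i with inl j => h j | inr j => h' j end.
exists (m + n)%N, (sel _ c c'), (sel _ g g'); split.
  by move=> i; rewrite /sel; case: split.
rewrite big_split_ord /=; congr (_ + _); apply: eq_bigr => i _; rewrite /sel.
  by rewrite (unsplitK (inl i)).
by rewrite (unsplitK (inr i)).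
Qed.

Lemma ideal_ofM A r p : ideal_of A p -> ideal_of A (r * p).
Proof.
move=> [n [c [g [Ag ->]]]]; exists n, (fun i => r * c i), g; split=> //.
by rewrite mulr_sumr; apply: eq_bigr => i _; rewrite mulrA.
Qed.

Lemma ideal_ofN A p : ideal_of A p -> ideal_of A (- p).
Proof. by rewrite -mulN1r; apply: ideal_ofM. Qed.

Lemma ideal_of_sum A (I : Type) (s : seq I) (Q : pred I) (F : I -> R) :
  (forall i, Q i -> ideal_of A (F i)) -> ideal_of A (\sum_(i <- s | Q i) F i).
Proof.
by move=> AF; apply: (big_ind (ideal_of A)) => //;
  [apply: ideal_of0 | apply: ideal_ofD].
Qed.

Lemma ideal_of_trans A B p :
  (forall a, A a -> ideal_of B a) -> ideal_of A p -> ideal_of B p.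
Proof.
move=> AB [n [c [g [Ag ->]]]]; apply: ideal_of_sum => i _.
exact/ideal_ofM/AB.
Qed.

Lemma minimal_generators_not_multiple A J g h r :
  minimal_generating_set A J -> A g -> A h -> g != h -> g <> r * h.
Proof.
move=> [genA minA] Ag Ah gh g_rh.
have [] := minA (fun p => A p /\ p != g) _ _ g Ag; [by move=> p [] | | by rewrite eqxx].
move=> p; rewrite genA; split; apply: ideal_of_trans => a.
  move=> Aa; have [->|ag] := eqVneq a g; last by apply: ideal_of_gen; split.
  by rewrite [X in ideal_of _ X]g_rh; apply/ideal_ofM/ideal_of_gen; split; rewrite // eq_sym.
by move=> [Aa _]; apply: ideal_of_gen.
Qed.

End IdealClosure.

(** * The Rees ideal as a toric ideal *)

Local Notation iT0 := (@Ordinal 5 0 isT).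
Local Notation iT1 := (@Ordinal 5 1 isT).
Local Notation iX0 := (@Ordinal 5 2 isT).
Local Notation iX1 := (@Ordinal 5 3 isT).
Local Notation iX2 := (@Ordinal 5 4 isT).

Section Exponents.
Local Open Scope ring_scope.

Definition mon (t0 t1 c e f : nat) : 'X_{1..5} :=
  [multinom nth 0 [:: t0; t1; c; e; f] i | i < 5].

Lemma monE t0 t1 c e f :
  ((mon t0 t1 c e f iT0 = t0) * (mon t0 t1 c e f iT1 = t1) *
  (mon t0 t1 c e f iX0 = c) * (mon t0 t1 c e f iX1 = e) *
  (mon t0 t1 c e f iX2 = f))%type.
Proof. by rewrite !mnmE. Qed.

Lemma forall_ord5 (Q : 'I_5 -> Prop) :
  Q iT0 -> Q iT1 -> Q iX0 -> Q iX1 -> Q iX2 -> forall i, Q i.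
Proof.
move=> Q0 Q1 Q2 Q3 Q4 [i lti].
by case: i lti => [|[|[|[|[|//]]]]] lti; rewrite (bool_irrelevance lti isT).
Qed.

Lemma mon_eta (m : 'X_{1..5}) : m = mon (m iT0) (m iT1) (m iX0) (m iX1) (m iX2).
Proof. by apply/mnmP; apply: forall_ord5; rewrite monE. Qed.

Lemma mnm_le5 (x m : 'X_{1..5}) :
  (x iT0 <= m iT0)%N -> (x iT1 <= m iT1)%N -> (x iX0 <= m iX0)%N ->
  (x iX1 <= m iX1)%N -> (x iX2 <= m iX2)%N -> (x <= m)%MM.
Proof. by move=> *; apply/mnm_lepP; apply: forall_ord5. Qed.

Lemma prod_ord5 (R : pzSemiRingType) (F : 'I_5 -> R) :
  \prod_i F i = F iT0 * F iT1 * F iX0 * F iX1 * F iX2.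
Proof.
rewrite !big_ord_recl big_ord0 mulr1 !mulrA.
by do !congr (_ * _); congr F; apply: val_inj.
Qed.

Lemma prod_ord2 (R : pzSemiRingType) (F : 'I_2 -> R) :
  \prod_i F i = F (@Ordinal 2 0 isT) * F (@Ordinal 2 1 isT).
Proof.
rewrite !big_ord_recl big_ord0 mulr1.
by do !congr (_ * _); congr F; apply: val_inj.
Qed.

Variable K : fieldType.

Lemma mpolyX_mon t0 t1 c e f : 'X_[mon t0 t1 c e f] =
  T0 K ^+ t0 * T1 K ^+ t1 * X0 K ^+ c * X1 K ^+ e * X2 K ^+ f.
Proof. by rewrite mpolyXE_id prod_ord5 !monE. Qed.

Variables d1 d2 u1 u2 : nat.

Local Notation phi := (@phi K d1 d2 u1 u2).
Local Notation rees_ideal := (rees_ideal K d1 d2 u1 u2).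

(** The image of the monomial m under [phi] is T0^(wtT0 m) T1^(wtT1 m) z^(wtz m). *)
Definition wtT0 (m : 'X_{1..5}) := (m iT0 + d1 * m iX0 + u1 * m iX1)%N.
Definition wtT1 (m : 'X_{1..5}) := (m iT1 + u2 * m iX1 + d2 * m iX2)%N.
Definition wtz (m : 'X_{1..5}) := (m iX0 + m iX1 + m iX2)%N.
Definition wtT (m : 'X_{1..5}) : 'X_{1..2} :=
  [multinom nth 0 [:: wtT0 m; wtT1 m] i | i < 2].

Definition same_fibre m m' := (wtT m == wtT m') && (wtz m == wtz m').

Lemma same_fibreP m m' : reflect
  [/\ wtT0 m = wtT0 m', wtT1 m = wtT1 m' & wtz m = wtz m'] (same_fibre m m').
Proof.
apply: (iffP andP) => [[/eqP/mnmP eT /eqP ez]|[e0 e1 ->]]; split=> //.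
- by have := eT (@Ordinal 2 0 isT); rewrite !mnmE.
- by have := eT (@Ordinal 2 1 isT); rewrite !mnmE.
- by apply/eqP/mnmP=> i; rewrite !mnmE e0 e1.
Qed.

Lemma same_fibreDl r m m' : same_fibre (r + m)%MM (r + m')%MM = same_fibre m m'.
Proof.
apply/same_fibreP/same_fibreP; rewrite /wtT0 /wtT1 /wtz !mnmDE !mulnDr;
  move=> [? ? ?]; split; lia.
Qed.

Lemma same_fibre_sym m m' : same_fibre m m' = same_fibre m' m.
Proof. by rewrite /same_fibre eq_sym [wtz m == _]eq_sym. Qed.

Lemma same_fibre_trans m2 m1 m3 :
  same_fibre m1 m2 -> same_fibre m2 m3 -> same_fibre m1 m3.
Proof. by rewrite /same_fibre; move=> /andP[/eqP-> /eqP->]. Qed.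

Lemma phiM p q : phi (p * q) = phi p * phi q.
Proof. exact: (rmorphM (mmap (polyC \o @mpolyC 2 K) (phi_vars K d1 d2 u1 u2))). Qed.

Lemma phi_sum (I : Type) (s : seq I) (F : I -> {mpoly K[5]}) :
  phi (\sum_(i <- s) F i) = \sum_(i <- s) phi (F i).
Proof. exact: (raddf_sum (mmap (polyC \o @mpolyC 2 K) (phi_vars K d1 d2 u1 u2))). Qed.

Lemma mmap1_phi m : mmap1 (phi_vars K d1 d2 u1 u2) m = ('X_[wtT m])%:P * 'X^(wtz m).
Proof.
pose x : {poly {mpoly K[2]}} := ('X_(@Ordinal 2 0 isT) : {mpoly K[2]})%:P.
pose y : {poly {mpoly K[2]}} := ('X_(@Ordinal 2 1 isT) : {mpoly K[2]})%:P.
have -> : ('X_[wtT m] : {mpoly K[2]})%:P = x ^+ wtT0 m * y ^+ wtT1 m.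
  by rewrite mpolyXE_id prod_ord2 !mnmE polyCM !polyC_exp.
have -> : mmap1 (phi_vars K d1 d2 u1 u2) m = x ^+ m iT0 * y ^+ m iT1
    * (x ^+ d1 * 'X) ^+ m iX0 * (x ^+ u1 * y ^+ u2 * 'X) ^+ m iX1 * (y ^+ d2 * 'X) ^+ m iX2.
  by rewrite /mmap1 prod_ord5 /x /y -!polyC_exp -polyCM.
rewrite /wtT0 /wtT1 /wtz; move: x y ('X)%R => x y z.
by rewrite !exprD !exprMn !exprM; ring.
Qed.

Lemma coef_phi p w k : ((phi p)`_k)@_w =
  \sum_(m <- msupp p | (wtT m == w) && (wtz m == k)) p@_m.
Proof.
rewrite /phi /mmap coef_sum raddf_sum /= [RHS]big_mkcond /=.
apply: eq_bigr => m _; rewrite mmap1_phi !coefCM coefXn mcoeffCM eq_sym.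
case: (wtz m == k); rewrite ?andbT ?andbF /=; last by rewrite mulr0 mcoeff0 mulr0.
by rewrite mulr1 mcoeffX; case: eqP; rewrite ?mulr1 ?mulr0.
Qed.

Lemma phi_binomial (a b : K) m m' : phi (a *: 'X_[m] + b *: 'X_[m']) =
  (a *: 'X_[wtT m])%:P * 'X^(wtz m) + (b *: 'X_[wtT m'])%:P * 'X^(wtz m').
Proof.
have phiE p : phi p = mmap (polyC \o @mpolyC 2 K) (phi_vars K d1 d2 u1 u2) p by [].
by rewrite phiE mmapD !mmapZ !mmapX !mmap1_phi /= -!mul_mpolyC !rmorphM /= !mulrA.
Qed.

Lemma rees_ideal_binomial m m' :
  same_fibre m m' -> rees_ideal ('X_[m] - 'X_[m']).
Proof.
move=> /andP[/eqP eT /eqP ez].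
rewrite /Defs.rees_ideal -[X in X - _]scale1r -scaleN1r phi_binomial eT ez -mulrDl -rmorphD.
by rewrite /= -scalerDl subrr scale0r mul0r.
Qed.

Lemma rees_pm_binomial p : pm_binomial p -> rees_ideal p ->
  exists (s : bool) m m', [/\ m != m', same_fibre m m'
    & p = (-1) ^+ s *: ('X_[m] - 'X_[m'])].
Proof.
move=> [s [s' [m [m' [mm' ->]]]]] /(congr1 (fun x : {poly {mpoly K[2]}} => (x`_(wtz m))@_(wtT m))).
rewrite phi_binomial coefD !coefCM !coefXn coef0 mcoeff0 eqxx mulr1.
rewrite mcoeffD mcoeffZ mcoeffX eqxx mulr1.
move=> e; exists s, m, m'; move: e; rewrite /same_fibre [wtT m == _]eq_sym.
case: (wtz m == wtz m') => /=; last first.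
  by rewrite mulr0 mcoeff0 addr0 => /eqP; rewrite signr_eq0.
rewrite mulr1 mcoeffZ mcoeffX; case: (wtT m' == wtT m) => /=; last first.
  by rewrite mulr0 addr0 => /eqP; rewrite signr_eq0.
rewrite mulr1 => /eqP; rewrite addrC addr_eq0 => /eqP ->.
by rewrite scaleNr scalerBr.
Qed.

Definition congruent A (m m' : 'X_{1..5}) :=
  ideal_of A ('X_[m] - 'X_[m'] : {mpoly K[5]}).

(** Replace each monomial of p by a representative of its fibre: modulo the
ideal p does not change, and the coefficients in each fibre add up to a
coefficient of [phi p], so to zero. *)
Lemma rees_ideal_spanned A p :
  (forall m m', same_fibre m m' -> congruent A m m') ->
  rees_ideal p -> ideal_of A p.
Proof.
move=> conn phi0.
pose rep m := nth m (msupp p) (find (same_fibre m) (msupp p)).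
have has_rep m : m \in msupp p -> has (same_fibre m) (msupp p).
  by move=> mp; apply/hasP; exists m => //; rewrite /same_fibre !eqxx.
have rep_fibre m : m \in msupp p -> same_fibre m (rep m).
  by move=> /has_rep; apply: nth_find.
have rep_eq m m' : m \in msupp p -> same_fibre m m' -> rep m = rep m'.
  move=> mp mm'.
  have efind : same_fibre m =1 same_fibre m'.
    move=> x; case/andP: mm' => /eqP eT /eqP ez; by rewrite /same_fibre eT ez.
  rewrite /rep -(eq_find efind); apply: set_nth_default.
  by rewrite -has_find has_rep.
have -> : p = \sum_(m <- msupp p) p@_m *: ('X_[m] - 'X_[rep m]).
  rewrite [LHS]mpolyE; apply/esym; rewrite (eq_bigr _ (fun m _ => scalerBr _ _ _)) sumrB.
  suff -> : \sum_(m <- msupp p) p@_m *: 'X_[rep m] = 0 by rewrite subr0.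
  apply/mpolyP => k; rewrite raddf_sum /= mcoeff0.
  under eq_bigr do rewrite mcoeffZ mcoeffX mulr_natr mulrb.
  rewrite -big_mkcond /=.
  have [/hasP[m0 m0p /eqP <-]|/hasPn no] := boolP (has (fun m => rep m == k) (msupp p)).
    transitivity ((phi p)`_(wtz m0))@_(wtT m0); last by rewrite phi0 coef0 mcoeff0.
    rewrite coef_phi big_seq_cond [RHS]big_seq_cond; apply: eq_bigl => m.
    apply: andb_id2l => mp; rewrite -/(same_fibre m m0).
    apply/eqP/idP => [em|]; last exact: rep_eq.
    by rewrite (same_fibre_trans (rep_fibre _ mp)) // em same_fibre_sym rep_fibre.
  by rewrite big_seq_cond big_pred0 // => m; apply/andP=> -[/no/negbTE->].
rewrite big_seq; apply: ideal_of_sum => m mp; rewrite -mul_mpolyC.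
exact/ideal_ofM/conn/rep_fibre.
Qed.

End Exponents.

(** * The binomials of the pairs, and their indispensability *)

Section Pairs.
Local Open Scope ring_scope.
Variables (K : fieldType) (d1 d2 u1 u2 : nat).

Definition powX1 p q := mon (d1 * p - u1 * (p + q)) (d2 * q - u2 * (p + q)) 0 (p + q) 0.
Definition prodX p q := mon (u1 * (p + q) - d1 * p) (u2 * (p + q) - d2 * q) p 0 q.

Local Notation same_fibre := (same_fibre d1 d2 u1 u2).
Local Notation rees_ideal := (rees_ideal K d1 d2 u1 u2).

(** The algorithm writes X1^j first exactly when T1 occurs on the side of X1^j,
that is, when u_2 j < d_2 q. As the sign depends on (p, q) only, a binomial and
its opposite are both output only if they are equal. *)
Definition pair_binomial p q : {mpoly K[5]} :=
  (-1) ^+ (d2 * q <= u2 * (p + q))%N *: ('X_[powX1 p q] - 'X_[prodX p q]).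

Lemma pair_fibre p q : same_fibre (powX1 p q) (prodX p q).
Proof. by apply/same_fibreP; rewrite /wtT0 /wtT1 /wtz !monE; split; lia. Qed.

Lemma powX1_neq p q p' q' : (0 < p + q)%N -> powX1 p q != prodX p' q'.
Proof.
move=> pq0; apply/eqP => /(congr1 (fun m : 'X_{1..5} => m iX1)).
by rewrite !monE; lia.
Qed.

Lemma prodX_inj p q p' q' : prodX p q = prodX p' q' -> (p, q) = (p', q').
Proof.
move=> e; have := congr1 (fun m : 'X_{1..5} => m iX0) e.
by have := congr1 (fun m : 'X_{1..5} => m iX2) e; rewrite !monE => -> ->.
Qed.

Lemma indispensable_fibre p q m : indispensable u1 d1 u2 d2 p q ->
  same_fibre (powX1 p q) m -> m = powX1 p q \/ m = prodX p q.
Proof.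
move=> [pq0 ind] /same_fibreP[]; rewrite /wtT0 /wtT1 /wtz !monE (mon_eta m) => e0 e1 ez.
rewrite monE in e0 e1 ez; rewrite !monE in e0 e1 ez.
case: (ind (m iX0) (m iX1) (m iX2)); try lia.
  by move=> [c e f]; left; congr mon; lia.
by move=> [c e f]; right; congr mon; lia.
Qed.

Lemma powX1_prodX_coprime p q r k k' :
  (r + k)%MM = powX1 p q -> (r + k')%MM = prodX p q -> r = 0%MM.
Proof.
move=> eL eR; apply/mnmP.
by apply: forall_ord5; rewrite mnm0E;
  match goal with |- _ ?i = _ =>
    have := congr1 (fun m : 'X_{1..5} => m i) eL;
    have := congr1 (fun m : 'X_{1..5} => m i) eR; rewrite !mnmDE !monE; lia end.
Qed.

Lemma pair_binomial_pm p q : (0 < p + q)%N -> pm_binomial (pair_binomial p q).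
Proof.
move=> pq0; rewrite /pair_binomial; case: (d2 * q <= _)%N.
  exists true, false, (powX1 p q), (prodX p q); split; first exact: powX1_neq.
  by rewrite scalerBr expr0 expr1 !scaleN1r opprK scale1r.
exists false, true, (powX1 p q), (prodX p q); split; first exact: powX1_neq.
by rewrite scalerBr expr0 expr1 scaleN1r !scale1r.
Qed.

Lemma rees_pair_binomial p q : rees_ideal (pair_binomial p q).
Proof.
have := rees_ideal_binomial K (pair_fibre p q); rewrite /Defs.rees_ideal /pair_binomial.
by rewrite -mul_mpolyC phiM => ->; rewrite mulr0.
Qed.

Lemma mcoeff_pair_prodX p q : (0 < p + q)%N ->
  (pair_binomial p q)@_(prodX p q) != 0.
Proof.
move=> pq0; rewrite mcoeffZ mcoeffB !mcoeffX eqxx (negbTE (powX1_neq _ _ pq0)).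
by rewrite sub0r mulrN1 oppr_eq0 signr_eq0.
Qed.

Lemma pair_binomial_neg p q p' q' : (0 < p + q)%N -> (0 < p' + q')%N ->
  pair_binomial p q = - pair_binomial p' q' -> (p, q) = (p', q').
Proof.
move=> pq0 pq0' e; have := mcoeff_pair_prodX pq0.
rewrite e mcoeffN mcoeffZ mcoeffB !mcoeffX (negbTE (powX1_neq _ _ pq0')).
have [/prodX_inj -> //|] := eqVneq (prodX p' q') (prodX p q).
by rewrite subrr mulr0 oppr0 eqxx.
Qed.

Lemma mcoeffMX_neq0 (p : {mpoly K[5]}) k m : (p * 'X_[k])@_m != 0 -> (k <= m)%MM.
Proof.
rewrite -mcoeff_msupp (perm_mem (msuppMX p k)) => /mapP[m' _ ->].
exact: lem_addr.
Qed.

(** Every way of moving from the first monomial inside its fibre ends at the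
second one, so a generating set of binomials has to contain this move. *)
Lemma indispensable_generator H p q :
  generates H rees_ideal -> (forall h, H h -> pm_binomial h) ->
  indispensable u1 d1 u2 d2 p q ->
  H (pair_binomial p q) \/ H (- pair_binomial p q).
Proof.
move=> genH pmH ind; have [pq0 _] := ind.
have [n [c [h [Hh gE]]]] := (genH _).1 (rees_ideal_binomial K (pair_fibre p q)).
(* Some summand contributes to the coefficient 1 of the first monomial. *)
have [i ci] : exists i, (c i * h i)@_(powX1 p q) != 0.
  apply/existsP; apply: contraT; rewrite negb_exists => /forallP h0.
  have := congr1 (mcoeff (powX1 p q)) gE.
  rewrite mcoeffB !mcoeffX eqxx eq_sym (negbTE (powX1_neq _ _ pq0)) subr0 raddf_sum /=.
  rewrite big1 => [/eqP|j _]; first by rewrite oner_eq0.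
  by apply/eqP; have := h0 j; rewrite negbK.
have rh : rees_ideal (h i) by apply/genH/ideal_of_gen.
have [s [k [k' [kk' fib hE]]]] := rees_pm_binomial (pmH _ (Hh i)) rh.
wlog kL : s k k' kk' fib hE / (k <= powX1 p q)%MM.
  move=> th; have [kL|kL] := boolP (k <= powX1 p q)%MM; first by apply: (th s k k').
  apply: (th (~~ s) k' k); rewrite 1?eq_sym 1?same_fibre_sym //.
    by rewrite hE signrN scaleNr -scalerN opprB.
  apply: (@mcoeffMX_neq0 (c i)); apply: contraNneq ci => ck'.
  have ck : (c i * 'X_[k])@_(powX1 p q) = 0.
    by apply/eqP; apply: contraNT kL; apply: mcoeffMX_neq0.
  by rewrite hE -scalerAr mcoeffZ mulrBr mcoeffB ck ck' subrr mulr0.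
(* The cofactor r moves k to the first monomial, hence k' to another one of the
   fibre, which must be the second; r divides both, so r = 1. *)
have rk := submK kL; set r := (powX1 p q - k)%MM in rk.
have : same_fibre (powX1 p q) (r + k')%MM by rewrite -rk same_fibreDl.
case/(indispensable_fibre ind) => rk'.
  by case/eqP: kk'; apply: (@addmI _ r); rewrite rk rk'.
have r0 := powX1_prodX_coprime rk rk'; move: rk rk' (Hh i); rewrite r0 !add0m hE.
move=> -> ->; rewrite /pair_binomial.
by case: s {hE} => /=; case: (_ <= _)%N; rewrite /= ?scaleN1r ?scale1r ?opprK; tauto.
Qed.

End Pairs.

(** * The output binomials generate *)

Section Connectivity.
Local Open Scope ring_scope.
Variables (K : fieldType) (d1 d2 u1 u2 : nat).
Hypotheses (hu1 : (0 < u1 < d1)%N) (hu2 : (0 < u2 < d2)%N).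
Variables (A : {mpoly K[5]} -> Prop) (P : nat -> nat -> Prop) (N : nat).
Hypothesis P_complete : complete_pairs u1 d1 u2 d2 P N.
Hypothesis PA : forall p q, P p q -> A (pair_binomial K d1 d2 u1 u2 p q).

Local Notation same_fibre := (same_fibre d1 d2 u1 u2).
Local Notation congruent := (@congruent K A).
Local Notation powX1 := (powX1 d1 d2 u1 u2).
Local Notation prodX := (prodX d1 d2 u1 u2).

Lemma congruent_refl m : congruent m m.
Proof. by rewrite /congruent subrr; apply: ideal_of0. Qed.

Lemma congruent_sym m m' : congruent m m' -> congruent m' m.
Proof. by move=> /ideal_ofN; rewrite opprB. Qed.

Lemma congruent_trans m2 m1 m3 : congruent m1 m2 -> congruent m2 m3 -> congruent m1 m3.
Proof. by move=> c12 c23; have := ideal_ofD c12 c23; rewrite addrA subrK. Qed.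

Lemma congruentDl r m m' : congruent m m' -> congruent (r + m)%MM (r + m')%MM.
Proof. by move=> /(ideal_ofM 'X_[r]); rewrite mulrBr -!mpolyXD. Qed.

Lemma congruent_pair p q : P p q -> congruent (powX1 p q) (prodX p q).
Proof.
move=> /PA/ideal_of_gen; rewrite /pair_binomial /congruent.
by case: (_ <= _)%N; rewrite ?scaleN1r ?scale1r // => /ideal_ofN; rewrite opprK.
Qed.

Definition total_wt m := (wtT0 d1 u1 m + wtT1 d2 u2 m + wtz m)%N.

Lemma total_wt_fibre m m' : same_fibre m m' -> total_wt m = total_wt m'.
Proof. by rewrite /total_wt => /same_fibreP[-> -> ->]. Qed.

Lemma total_wt_var i m : (total_wt m < total_wt (U_(i) + m)%MM)%N.
Proof.
move: i; apply: forall_ord5; rewrite /total_wt /wtT0 /wtT1 /wtz !mnmDE !mnm1E /=; nia.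
Qed.

Section Step.
Variable n : nat.
Hypothesis IH : forall m m', (total_wt m < n)%N -> same_fibre m m' -> congruent m m'.

(** Cancelling the common variable leads to a fibre of smaller weight. *)
Lemma congruent_common i m m' : (total_wt m <= n)%N -> same_fibre m m' ->
  (0 < m i)%N -> (0 < m' i)%N -> congruent m m'.
Proof.
have Ui (k : 'X_{1..5}) : (0 < k i)%N -> k = (U_(i) + (k - U_(i)))%MM.
  move=> ki; apply/mnmP => j; rewrite mnmDE mnmBE mnm1E.
  by have [<-|] := eqVneq i j; rewrite /=; lia.
move=> wm + /Ui mE /Ui m'E; rewrite mE m'E same_fibreDl => fib.
by apply/congruentDl/IH => //; apply: leq_trans wm;
  rewrite [X in (_ < total_wt X)%N]mE total_wt_var.
Qed.

(** Replacing the divisor x of m by y stays in the fibre, and creates the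
variable of index i that m' contains. *)
Lemma congruent_move i x y m m' : (total_wt m <= n)%N -> same_fibre m m' ->
  congruent x y -> same_fibre x y -> (x <= m)%MM ->
  (0 < y i)%N -> (0 < m' i)%N -> congruent m m'.
Proof.
move=> wm fib cxy fxy /submK xm yi m'i.
have c : congruent m (m - x + y)%MM by rewrite -{1}xm; apply: congruentDl.
have f : same_fibre (m - x + y)%MM m'.
  by apply: same_fibre_trans fib; rewrite -{2}xm same_fibreDl same_fibre_sym.
apply: congruent_trans c _; apply: (@congruent_common i) => //.
  by rewrite (total_wt_fibre f) -(total_wt_fibre fib).
by rewrite mnmDE; lia.
Qed.

(** In each case some output pair moves one of m and m' to a monomial that shares
a variable with the other. *)
Lemma congruent_step m m' : (total_wt m <= n)%N -> same_fibre m m' -> congruent m m'.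
Proof.
wlog e'0 : m m' / m' iX1 = 0%N.
  move=> th wm fib; have [e'0|e'0] := posnP (m' iX1); first exact: th.
  have [e0|e0] := posnP (m iX1); last exact: (@congruent_common iX1).
  by apply/congruent_sym/th; rewrite 1?same_fibre_sym // -(total_wt_fibre fib).
move=> wm fib; case: (same_fibreP _ _ _ _ _ _ fib); rewrite /wtT0 /wtT1 /wtz.
have [[_ P10 P01] _ _ _ _] := P_complete.
have common i : (0 < m i)%N -> (0 < m' i)%N -> congruent m m'.
  exact: congruent_common.
have [c10 c01] := (congruent_pair P10, congruent_pair P01).
have [f10 f01] := (pair_fibre d1 d2 u1 u2 1 0, pair_fibre d1 d2 u1 u2 0 1).
move=> w0 w1 wz.
(* If m' contains at most one of X0 and X2, the initial pairs suffice. *)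
have [c'0|c'0] := posnP (m' iX0); have [f'0|f'0] := posnP (m' iX2).
- have -> : m = m' by rewrite (mon_eta m) (mon_eta m'); congr mon; nia.
  exact: congruent_refl.
- have [f0|f0] := posnP (m iX2); last exact: (common iX2).
  have [e0|e0] := posnP (m iX1).
    apply: (congruent_move (i := iT0)) (congruent_sym c10) _ _ _ _ => //.
    + by rewrite same_fibre_sym.
    + by apply: mnm_le5; rewrite !monE; nia.
    + by rewrite monE; lia.
    + nia.
  apply: (congruent_move (i := iX2)) c01 _ _ _ _ => //; last by rewrite monE.
  by apply: mnm_le5; rewrite !monE; nia.
- have [c0|c0] := posnP (m iX0); last exact: (common iX0).
  have [e0|e0] := posnP (m iX1).
    apply: (congruent_move (i := iT1)) (congruent_sym c01) _ _ _ _ => //.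
    + by rewrite same_fibre_sym.
    + by apply: mnm_le5; rewrite !monE; nia.
    + by rewrite monE; lia.
    + nia.
  apply: (congruent_move (i := iX0)) c10 _ _ _ _ => //; last by rewrite monE.
  by apply: mnm_le5; rewrite !monE; nia.
have [c0|c0] := posnP (m iX0); last exact: (common iX0).
have [f0|f0] := posnP (m iX2); last exact: (common iX2).
(* Now m is X1^e and m' is X0^c X2^f with c, f > 0, up to T0 and T1. *)
have e0 : (0 < m' iX0 + m' iX2)%N by lia.
have [p [q [Ppq [[h1 h2 h3 h4]|[h1 h2 h3 h4 h5]]]]] := exchange hu1 hu2 P_complete e0.
  have cpq := congruent_pair Ppq; have fpq := pair_fibre d1 d2 u1 u2 p q.
  have le : (powX1 p q <= m)%MM by apply: mnm_le5; rewrite !monE; nia.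
  case/orP: h4 => /andP[].
    by move=> p0 _; apply: (congruent_move (i := iX0)) cpq _ _ _ _; rewrite ?monE.
  by move=> q0 _; apply: (congruent_move (i := iX2)) cpq _ _ _ _; rewrite ?monE.
apply: congruent_sym.
apply: (congruent_move (i := iX1)) (congruent_sym (congruent_pair Ppq)) _ _ _ _.
- by rewrite -(total_wt_fibre fib).
- by rewrite same_fibre_sym.
- by rewrite same_fibre_sym pair_fibre.
- by apply: mnm_le5; rewrite !monE; nia.
- by rewrite monE.
- lia.
Qed.

End Step.

Lemma fibre_congruent m m' : same_fibre m m' -> congruent m m'.
Proof.
have [n] := ubnP (total_wt m).
elim: n m m' => // n IH m m' wm; exact: (congruent_step IH).
Qed.

Lemma complete_pairs_generate p : rees_ideal K d1 d2 u1 u2 p -> ideal_of A p.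
Proof. exact: rees_ideal_spanned fibre_congruent. Qed.

End Connectivity.

(** * Correctness of the algorithm *)

(** Invariant of one pair of extremal values. They are attained at a common
index k, since the two sequences of residues are ordered in opposite ways. *)
Definition tracks u1 d1 u2 d2 (P : nat -> nat -> Prop) N mn mx :=
  [/\ exists k, [/\ 0 < k < N, mn = res u1 d1 k & mx = res u2 d2 k],
      forall i, 0 < i < N -> mn <= res u1 d1 i /\ res u2 d2 i <= mx
    & records_cover u1 d1 u2 d2 P N].

Lemma records_cover_sub u1 d1 u2 d2 (P P' : nat -> nat -> Prop) N :
  (forall p q, P p q -> P' p q) ->
  records_cover u1 d1 u2 d2 P N -> records_cover u1 d1 u2 d2 P' N.
Proof. by move=> PP' cov e /cov[k [ke /PP' Pk rk]]; exists k. Qed.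

Lemma quo1 u d : u < d -> quo u d 1 = 0.
Proof. by move=> ud; rewrite /quo muln1 divn_small. Qed.

Lemma res1 u d : u < d -> res u d 1 = u.
Proof. by move=> ud; rewrite /res muln1 modn_small. Qed.

Lemma quoS u d j : u < d -> quo u d j.+1 = quo u d j + (d <= res u d j + u).
Proof. by move=> ud; rewrite -addn1 quoD ?quo1 ?res1 ?addn0 //; lia. Qed.

Lemma resS u d j : u < d -> res u d j.+1 + d * (d <= res u d j + u) = res u d j + u.
Proof. by move=> ud; have := @resD u d _ j 1; rewrite res1 // addn1 => -> //; lia. Qed.

Section Tracking.
Variables (u1 d1 u2 d2 : nat).
Hypotheses (u1_gt0 : 0 < u1) (u1_lt : u1 < d1) (u2_gt0 : 0 < u2) (u2_lt : u2 < d2).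

(** The index of a new record covers itself; the earlier indices are covered
as before. *)
Lemma tracks_record P P' j mn mx : regular u1 d1 u2 d2 j ->
  (quo u1 d1 j + quo u2 d2 j).+1 = j -> tracks u1 d1 u2 d2 P j mn mx ->
  (forall p q, P p q -> P' p q) ->
  P' (quo u1 d1 j) (quo u2 d2 j).+1 -> res u1 d1 j < mn -> mx < res u2 d2 j ->
  tracks u1 d1 u2 d2 P' j.+1 (res u1 d1 j) (res u2 d2 j).
Proof.
move=> reg bj [[k [kj kmn kmx]] bnd cov] PP' Pj mnj mxj; split.
- by exists j; split=> //; lia.
- move=> i ij; have [->//|ij'] : i = j \/ i < j by lia.
  by have [|] := bnd i; lia.
move=> e ej; have [->|ej'] : e = j \/ e < j by lia.
  by exists j; split=> //; lia.
by apply: (records_cover_sub PP' cov); lia.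
Qed.

(** If j fails one of the two tests, comparing j with the index k that attains the
extremal values shows that it fails both, so that the pair covering k also
covers j. *)
Lemma tracks_no_record P P' j mn mx : regular u1 d1 u2 d2 j ->
  (quo u1 d1 j + quo u2 d2 j).+1 = j -> tracks u1 d1 u2 d2 P j mn mx ->
  (forall p q, P p q -> P' p q) ->
  ~~ ((res u1 d1 j < mn) && (mx < res u2 d2 j)) ->
  tracks u1 d1 u2 d2 P' j.+1 mn mx.
Proof.
move=> reg bj [[k [kj kmn kmx]] bnd cov] PP' nrec.
have [[anti1 anti2]|[anti1 anti2]] :=
  res_antitone u1_gt0 u1_lt u2_gt0 u2_lt reg bj kj; last first.
  by move: nrec; rewrite kmn kmx anti1 anti2.
split.
- by exists k; split=> //; lia.
- move=> i ij; have [->//|ij'] : i = j \/ i < j by lia.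
    by rewrite kmn kmx; split; exact: ltnW.
  by apply: bnd; lia.
move=> e ej; have [->|ej'] : e = j \/ e < j by lia.
  by have [k' [k'k Pk' rk']] := cov k kj; exists k'; split; [lia|exact: PP'|lia].
by apply: (records_cover_sub PP' cov); lia.
Qed.

(** A vanishing residue is smaller than all the previous ones, hence the other
residue is a new maximum: the pair at which the algorithm stops for this reason
has been output. *)
Lemma tracks_zero_record P j mn mx : regular u1 d1 u2 d2 j ->
  (quo u1 d1 j + quo u2 d2 j).+1 = j -> tracks u1 d1 u2 d2 P j mn mx ->
  res u1 d1 j = 0 -> (res u1 d1 j < mn) && (mx < res u2 d2 j).
Proof.
move=> reg bj [[k [kj -> ->]] _ _] a0; rewrite a0.
have [[]|[]] := res_antitone u1_gt0 u1_lt u2_gt0 u2_lt reg bj kj; rewrite a0 //.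
by move=> -> ->.
Qed.

End Tracking.

Section Run.
Variables (K : fieldType) (d1 d2 u1 u2 : nat).
Hypotheses (u1_gt0 : 0 < u1) (u1_lt : u1 < d1) (u2_gt0 : 0 < u2) (u2_lt : u2 < d2).

Let d1_gt0 : 0 < d1. Proof. lia. Qed.
Let d2_gt0 : 0 < d2. Proof. lia. Qed.

Local Notation b1 := (quo u1 d1).
Local Notation b2 := (quo u2 d2).
Local Notation a1 := (res u1 d1).
Local Notation a2 := (res u2 d2).
Local Notation binom := (fun x : nat * nat => pair_binomial K d1 d2 u1 u2 x.1 x.2).

Section Binomials.
Local Open Scope ring_scope.

Lemma pair_binomial_record1 j : (b1 j + b2 j).+1 = j ->
  pair_binomial K d1 d2 u1 u2 (b1 j).+1 (b2 j) =
  T1 K ^+ a2 j * X0 K ^+ (b1 j).+1 * X2 K ^+ b2 j - T0 K ^+ (d1 - a1 j) * X1 K ^+ j.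
Proof.
move=> bj; have q1 := quo_res u1 d1 j; have q2 := quo_res u2 d2 j.
have l1 := res_lt u1 d1_gt0 j.
rewrite /pair_binomial /powX1 /prodX addSn bj !mpolyX_mon.
have -> : (d2 * b2 j <= u2 * j)%N by lia.
have -> : (d1 * (b1 j).+1 - u1 * j = d1 - a1 j)%N by nia.
have -> : (d2 * b2 j - u2 * j = 0)%N by lia.
have -> : (u1 * j - d1 * (b1 j).+1 = 0)%N by nia.
have -> : (u2 * j - d2 * b2 j = a2 j)%N by lia.
by rewrite !expr0 !mulr1 mul1r expr1 scaleN1r opprB.
Qed.

Lemma pair_binomial_record2 j : (b1 j + b2 j).+1 = j ->
  pair_binomial K d1 d2 u1 u2 (b1 j) (b2 j).+1 =
  T1 K ^+ (d2 - a2 j) * X1 K ^+ j - T0 K ^+ a1 j * X0 K ^+ b1 j * X2 K ^+ (b2 j).+1.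
Proof.
move=> bj; have q1 := quo_res u1 d1 j; have q2 := quo_res u2 d2 j.
have l2 := res_lt u2 d2_gt0 j.
rewrite /pair_binomial /powX1 /prodX addnS bj !mpolyX_mon.
have -> : (d2 * (b2 j).+1 <= u2 * j)%N = false by nia.
have -> : (d1 * b1 j - u1 * j = 0)%N by lia.
have -> : (d2 * (b2 j).+1 - u2 * j = d2 - a2 j)%N by nia.
have -> : (u1 * j - d1 * b1 j = a1 j)%N by lia.
have -> : (u2 * j - d2 * (b2 j).+1 = 0)%N by nia.
by rewrite !expr0 !mulr1 mul1r scale1r.
Qed.

Lemma pair_binomial_ceil j : (b1 j + b2 j).+2 = j ->
  pair_binomial K d1 d2 u1 u2 (b1 j).+1 (b2 j).+1 =
  T0 K ^+ (d1 - a1 j) * T1 K ^+ (d2 - a2 j) * X1 K ^+ j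
    - X0 K ^+ (b1 j).+1 * X2 K ^+ (b2 j).+1.
Proof.
move=> bj; have q1 := quo_res u1 d1 j; have q2 := quo_res u2 d2 j.
have l1 := res_lt u1 d1_gt0 j; have l2 := res_lt u2 d2_gt0 j.
rewrite /pair_binomial /powX1 /prodX addnS addSn bj !mpolyX_mon.
have -> : (d2 * (b2 j).+1 <= u2 * j)%N = false by nia.
have -> : (d1 * (b1 j).+1 - u1 * j = d1 - a1 j)%N by nia.
have -> : (d2 * (b2 j).+1 - u2 * j = d2 - a2 j)%N by nia.
have -> : (u1 * j - d1 * (b1 j).+1 = 0)%N by nia.
have -> : (u2 * j - d2 * (b2 j).+1 = 0)%N by nia.
by rewrite !expr0 !mulr1 !mul1r scale1r.
Qed.

Lemma pair_binomial_floor j : (b1 j + b2 j)%N = j ->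
  pair_binomial K d1 d2 u1 u2 (b1 j) (b2 j) =
  T0 K ^+ a1 j * T1 K ^+ a2 j * X0 K ^+ b1 j * X2 K ^+ b2 j - X1 K ^+ j.
Proof.
move=> bj; have q1 := quo_res u1 d1 j; have q2 := quo_res u2 d2 j.
rewrite /pair_binomial /powX1 /prodX bj !mpolyX_mon.
have -> : (d2 * b2 j <= u2 * j)%N by lia.
have -> : (d1 * b1 j - u1 * j = 0)%N by lia.
have -> : (d2 * b2 j - u2 * j = 0)%N by lia.
have -> : (u1 * j - d1 * b1 j = a1 j)%N by lia.
have -> : (u2 * j - d2 * b2 j = a2 j)%N by lia.
by rewrite !expr0 !mulr1 !mul1r expr1 scaleN1r opprB.
Qed.

Lemma initial_pairs :
  output (initial K d1 d2 u1 u2) = [seq binom x | x <- [:: (1, 0); (0, 1)]]%N.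
Proof.
rewrite /= /pair_binomial /powX1 /prodX !mpolyX_mon.
rewrite add0n addn0 !muln1 !muln0 !sub0n !subn0 leq0n leqNgt u2_lt /=.
have [-> ->] : (u1 - d1 = 0 /\ u2 - d2 = 0)%N by lia.
by rewrite !expr0 !expr1 !mulr1 !mul1r scaleN1r scale1r opprB.
Qed.

End Binomials.

Definition in_list (s : seq (nat * nat)) p q : Prop := (p, q) \in s.

Definition indispensable_list s :=
  forall p q, in_list s p q -> indispensable u1 d1 u2 d2 p q.

Record invariant j (st : state K) s : Prop := Invariant {
  inv_running : stopped st = false;
  inv_output : output st = [seq binom x | x <- s];
  inv_indispensable : indispensable_list s;
  inv_initial : in_list s 1 0 /\ in_list s 0 1;
  inv_regular : regular u1 d1 u2 d2 j.+1;
  inv_tracks2 : tracks u1 d1 u2 d2 (in_list s) j.+1 (min1 st) (max2 st);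
  inv_tracks1 :
    tracks u2 d2 u1 d1 (fun q p => in_list s p q) j.+1 (min2 st) (max1 st)
}.

Definition finished j (st : state K) := stopped st /\ exists s,
  [/\ output st = [seq binom x | x <- s], indispensable_list s
    & complete_pairs u1 d1 u2 d2 (in_list s) j].

Lemma indispensable_cons p q s : indispensable u1 d1 u2 d2 p q ->
  indispensable_list s -> indispensable_list ((p, q) :: s).
Proof.
move=> pq ind p' q'; rewrite /in_list in_cons => /orP[/eqP[-> ->] //|]; exact: ind.
Qed.

Lemma in_list_cons x s p q : in_list s p q -> in_list (x :: s) p q.
Proof. by rewrite /in_list in_cons => ->; rewrite orbT. Qed.

Lemma in_list_head p q s : in_list ((p, q) :: s) p q.
Proof. by rewrite /in_list mem_head. Qed.

Lemma regular2 : regular u1 d1 u2 d2 2.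
Proof. by move=> k k2; have -> : k = 1; [lia|rewrite !res1 // !quo1]. Qed.

Lemma indispensable10 : indispensable u1 d1 u2 d2 1 0.
Proof.
have reg : regular u2 d2 u1 d1 1 by move=> k; lia.
have := @indispensable_record u2 d2 u1 d1 u2_gt0 u2_lt u1_gt0 u1_lt 1 isT reg.
by rewrite !quo1 // => ind; apply/indispensable_sym/ind => // i; lia.
Qed.

Lemma indispensable01 : indispensable u1 d1 u2 d2 0 1.
Proof.
have reg : regular u1 d1 u2 d2 1 by move=> k; lia.
have := @indispensable_record u1 d1 u2 d2 u1_gt0 u1_lt u2_gt0 u2_lt 1 isT reg.
by rewrite !quo1 // => ind; apply: ind => // i; lia.
Qed.

Lemma initial_invariant : invariant 1 (initial K d1 d2 u1 u2) [:: (1, 0); (0, 1)].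
Proof.
have one k : 0 < k < 2 -> k = 1 by lia.
split=> //=; try exact: initial_pairs; try exact: regular2.
- apply: indispensable_cons; first exact: indispensable10.
  by apply: indispensable_cons; first exact: indispensable01.
- split; first by exists 1; rewrite !res1.
    by move=> i /one ->; rewrite !res1.
  by move=> e /one ->; exists 1; rewrite !quo1.
split; first by exists 1; rewrite !res1.
  by move=> i /one ->; rewrite !res1.
by move=> e /one ->; exists 1; rewrite !quo1.
Qed.

(** The first two branches add the pair of ceilings, respectively floors, as last
pair. In the third one exactly one quotient has increased, both kinds of
records are updated, and either regularity extends to the new index or a
residue vanishes; the corresponding record is then the last pair. *)
Lemma step_invariant j st s : 0 < j -> invariant j st s ->
  finished j.+1 (step d1 d2 u1 u2 j.+1 st) \/
  exists s', invariant j.+1 (step d1 d2 u1 u2 j.+1 st) s'.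
Proof.
move=> j0 [run out ind [in10 in01] reg tr2 tr1].
have [r1 r2 bj] := reg j ltac:(lia).
have [q1 q2] := (quo_res u1 d1 j.+1, quo_res u2 d2 j.+1).
have [l1 l2] := (res_lt u1 d1_gt0 j.+1, res_lt u2 d2_gt0 j.+1).
have [s1 s2] := (resS j u1_lt, resS j u2_lt).
have [t1 t2] := (quoS j u1_lt, quoS j u2_lt).
have [cov2 cov1] : records_cover u1 d1 u2 d2 (in_list s) j.+1
    /\ records_cover u2 d2 u1 d1 (fun q p => in_list s p q) j.+1.
  by case: tr2 tr1 => _ _ c2 [_ _ c1].
have finish p q : indispensable u1 d1 u2 d2 p q ->
    p + q = j.+1 -> final_pair u1 d1 u2 d2 p q ->
    forall st', output st' = binom (p, q) :: output st -> stopped st' -> finished j.+1 st'.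
  move=> ipq pq fin st' out' stop; split=> //; exists ((p, q) :: s); split.
  - by rewrite out' out.
  - exact: indispensable_cons.
  split=> //; first by split=> //; apply: in_list_cons.
  - by apply: records_cover_sub cov2 => ? ?; apply: in_list_cons.
  - by apply: records_cover_sub cov1 => ? ?; apply: in_list_cons.
  by exists p, q; split=> //; apply: in_list_head.
rewrite /step run /= -![Defs.b1 _ _ _]/(b1 _) -![Defs.b2 _ _ _]/(b2 _)
  -![Defs.a1 _ _ _]/(a1 _) -![Defs.a2 _ _ _]/(a2 _).
case: ifP => [/andP[nj1 nj2]|nojump].
  left; have bj2 : (b1 j.+1 + b2 j.+1).+2 = j.+1.
    by move: nj1 nj2; case: (d1 <= _) t1 => t1; case: (d2 <= _) t2 => t2; lia.
  have [z1 z2] : 0 < a1 j.+1 /\ 0 < a2 j.+1.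
    by move: nj1 nj2; case: (d1 <= _) s1 t1 => s1 t1; case: (d2 <= _) s2 t2 => s2 t2; lia.
  apply: (finish (b1 j.+1).+1 (b2 j.+1).+1) => //=.
  - exact: indispensable_ceil.
  - lia.
  - by right; rewrite /final_pair addSn addnS bj2 !mulnS; split; lia.
  by rewrite pair_binomial_ceil.
case: ifP => [/andP[yj1 yj2]|notboth].
  left; have bj0 : b1 j.+1 + b2 j.+1 = j.+1 by lia.
  apply: (finish (b1 j.+1) (b2 j.+1)) => //=.
  - exact: indispensable_floor.
  - by left; rewrite bj0; split; lia.
  by rewrite pair_binomial_floor.
have bj1 : (b1 j.+1 + b2 j.+1).+1 = j.+1.
  by move: nojump notboth; case: (d1 <= _) t1 => t1; case: (d2 <= _) t2 => t2; lia.
have bj1' : (b2 j.+1 + b1 j.+1).+1 = j.+1 by rewrite addnC.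
have reg' := regular_sym reg.
pose rec1 := (max1 st < a1 j.+1) && (a2 j.+1 < min2 st).
pose rec2 := (a1 j.+1 < min1 st) && (max2 st < a2 j.+1).
pose s' := if rec1 then ((b1 j.+1).+1, b2 j.+1) :: s else s.
pose s'' := if rec2 then (b1 j.+1, (b2 j.+1).+1) :: s' else s'.
have sub p q : in_list s p q -> in_list s'' p q.
  by rewrite /s'' /s' => ?; case: (rec2); case: (rec1); do ?apply: in_list_cons.
have sub' q p : in_list s p q -> in_list s'' p q by apply: sub.
have in1 : rec1 -> in_list s'' (b1 j.+1).+1 (b2 j.+1).
  by rewrite /s'' /s' => ->; rewrite /in_list; case: (rec2); rewrite !inE eqxx ?orbT.
have in2 : rec2 -> in_list s'' (b1 j.+1) (b2 j.+1).+1.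
  by rewrite /s'' => ->; apply: in_list_head.
set st' := update2 _ _ _ _ _ (update1 _ _ _ _ _ st).
have [run' out' tr2' tr1'] : [/\ stopped st' = false,
    output st' = [seq binom x | x <- s''],
    tracks u1 d1 u2 d2 (in_list s'') j.+2 (min1 st') (max2 st')
    & tracks u2 d2 u1 d1 (fun q p => in_list s'' p q) j.+2 (min2 st') (max1 st')].
  have stE : st = State (max1 st) (min1 st) (max2 st) (min2 st) (output st) (stopped st).
    by case: (st).
  have st'E : st' = State (if rec1 then a1 j.+1 else max1 st)
      (if rec2 then a1 j.+1 else min1 st) (if rec2 then a2 j.+1 else max2 st)
      (if rec1 then a2 j.+1 else min2 st) [seq binom x | x <- s''] false.
    rewrite /st' /update1 -![Defs.b1 _ _ _]/(b1 _) -![Defs.b2 _ _ _]/(b2 _)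
      -![Defs.a1 _ _ _]/(a1 _) -![Defs.a2 _ _ _]/(a2 _) -/rec1 /s'' /s'.
    rewrite -(pair_binomial_record1 bj1).
    rewrite /update2 -![Defs.b1 _ _ _]/(b1 _) -![Defs.b2 _ _ _]/(b2 _)
      -![Defs.a1 _ _ _]/(a1 _) -![Defs.a2 _ _ _]/(a2 _) -(pair_binomial_record2 bj1).
    by case: (rec1); rewrite /= -/rec2; case: (rec2); rewrite /= ?run ?out // [LHS]stE run out.
  rewrite st'E /=; split=> //.
    case: (boolP rec2) => [r|]; last exact: (tracks_no_record _ _ _ _ reg bj1 tr2 sub).
    have /andP[? ?] := r; apply: tracks_record tr2 sub _ _ _ => //; exact: in2.
  case: (boolP rec1) => [r|]; last first.
    by rewrite /rec1 andbC; apply: (tracks_no_record _ _ _ _ reg' bj1' tr1 sub').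
  have /andP[? ?] := r; apply: tracks_record tr1 sub' _ _ _ => //; exact: in1.
have ind'' : indispensable_list s''.
  have ind' : indispensable_list s'.
    rewrite /s'; case: (boolP rec1) => // /andP[m1 m2].
    apply: indispensable_cons => //; apply/indispensable_sym/indispensable_record => //.
    by case: tr1 => _ bnd _ i ij; have [_] := bnd i ij; lia.
  rewrite /s''; case: (boolP rec2) => // /andP[m1 m2].
  apply: indispensable_cons => //; apply/indispensable_record => //.
  by case: tr2 => _ bnd _ i ij; have [_] := bnd i ij; lia.
have [z1|z1] := posnP (a1 j.+1).
  left; split=> //; exists s''; split=> //; split=> //; first by split; [|exact: sub|exact: sub].
  - exact: records_cover_sub sub cov2.
  - exact: records_cover_sub sub' cov1.
  have r := tracks_zero_record u1_gt0 u1_lt u2_gt0 u2_lt reg bj1 tr2 z1.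
  exists (b1 j.+1), (b2 j.+1).+1; split; [exact: in2|lia|right].
  by rewrite addnS bj1 mulnS; move: r => /andP[_ r]; clear - q1 q2 l1 l2 r z1; split; lia.
have [z2|z2] := posnP (a2 j.+1).
  left; split=> //; exists s''; split=> //; split=> //; first by split; [|exact: sub|exact: sub].
  - exact: records_cover_sub sub cov2.
  - exact: records_cover_sub sub' cov1.
  have r := tracks_zero_record u2_gt0 u2_lt u1_gt0 u1_lt reg' bj1' tr1 z2.
  exists (b1 j.+1).+1, (b2 j.+1); split; [apply: in1; rewrite /rec1 andbC //|lia|right].
  by rewrite addSn bj1 mulnS; move: r => /andP[_ r]; clear - q1 q2 l1 l2 r z2; split; lia.
right; exists s''; split=> //=; first by split; apply: sub.
move=> k kj; have [->|kj'] : k = j.+1 \/ k < j.+1 by lia.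
  by split.
by apply: reg; lia.
Qed.

Lemma runS j : run K d1 d2 u1 u2 j.+2 = step d1 d2 u1 u2 j.+2 (run K d1 d2 u1 u2 j.+1).
Proof.
have iotaS : iota 2 j.+1 = iota 2 j ++ [:: j.+2] by have := iotaD 2 j 1; rewrite addn1 add2n.
by rewrite /run ![_.-1]/= iotaS foldl_cat.
Qed.

Lemma run_finished_or_invariant j : 0 < j ->
  (exists i, 0 < i <= j /\ finished i (run K d1 d2 u1 u2 i)) \/
  exists s, invariant j (run K d1 d2 u1 u2 j) s.
Proof.
case: j => // j _; elim: j => [|j [[i [ij fin]]|[s inv]]].
- by right; exists [:: (1, 0); (0, 1)]; exact: initial_invariant.
- by left; exists i; split=> //; lia.
rewrite runS; have [fin|[s' inv']] := step_invariant (ltn0Sn j) inv.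
  by left; exists j.+2; rewrite runS; split=> //; lia.
by right; exists s'.
Qed.

Lemma res_period u d : 0 < d -> res u d (d %/ gcdn d u) = 0.
Proof.
move=> d0; rewrite /res; apply/eqP; rewrite -/(dvdn _ _).
by rewrite muln_divA ?dvdn_gcdl // mulnC -muln_divA ?dvdn_gcdr // dvdn_mulr.
Qed.

Lemma run_finishes : exists i,
  0 < i <= minn (d1 %/ gcdn d1 u1) (d2 %/ gcdn d2 u2) /\
  finished i (run K d1 d2 u1 u2 i).
Proof.
set q := minn _ _.
have [p1 p2] := (res_period u1 d1_gt0, res_period u2 d2_gt0).
have q0 : 0 < q.
  rewrite /q leq_min !divn_gt0 ?gcdn_gt0 ?d1_gt0 ?d2_gt0 //.
  by apply/andP; split; apply: dvdn_leq (dvdn_gcdl _ _).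
have [//|[s inv]] := run_finished_or_invariant q0.
have reg := inv_regular inv; have [|r1 r2 _] := reg q; first lia.
by move: r1 r2; rewrite /q /minn; case: ifP => _; rewrite ?p1 ?p2.
Qed.

End Run.

(** Each violated inequality makes one of the three monomials divide another. *)
Lemma exponents_bounds (K : fieldType) (d1 d2 u1 u2 : nat) :
  uniq (I_gens K d1 d2 u1 u2) ->
  minimal_generating_set (in_seq (I_gens K d1 d2 u1 u2)) (I_ideal K d1 d2 u1 u2) ->
  0 < u1 < d1 /\ 0 < u2 < d2.
Proof.
rewrite /I_gens; set t0 := 'X_(_); set t1 := 'X_(_); set g := [:: _; _; _] => /=.
rewrite !inE negb_or andbT => /andP[/andP[g01 g02] g12] min.
have g0 : in_seq g (t0 ^+ d1)%R by rewrite /in_seq !inE eqxx.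
have g1 : in_seq g (t0 ^+ u1 * t1 ^+ u2)%R by rewrite /in_seq !inE eqxx orbT.
have g2 : in_seq g (t1 ^+ d2)%R by rewrite /in_seq !inE eqxx !orbT.
have u1d1 : u1 < d1.
  rewrite ltnNge; apply/negP => du.
  apply: (minimal_generators_not_multiple (r := (t0 ^+ (u1 - d1) * t1 ^+ u2)%R) min g1 g0).
    by rewrite eq_sym.
  by rewrite mulrAC -exprD subnK.
have u2d2 : u2 < d2.
  rewrite ltnNge; apply/negP => du.
  apply: (minimal_generators_not_multiple (r := (t0 ^+ u1 * t1 ^+ (u2 - d2))%R) min g1 g2) => //.
  by rewrite -mulrA -exprD subnK.
rewrite u1d1 u2d2 !andbT !lt0n; split; apply/eqP => u0.
  apply: (minimal_generators_not_multiple (r := (t1 ^+ (d2 - u2))%R) min g2 g1).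
    by rewrite eq_sym.
  by rewrite u0 expr0 mul1r -exprD subnK // ltnW.
apply: (minimal_generators_not_multiple (r := (t0 ^+ (d1 - u1))%R) min g0 g1) => //.
by rewrite u0 expr0 mulr1 -exprD subnK // ltnW.
Qed.

Theorem theorem3p1 (K : fieldType) (d1 d2 u1 u2 : nat)
  (gens_distinct : uniq (I_gens K d1 d2 u1 u2))
  (gens_minimal : minimal_generating_set
     (in_seq (I_gens K d1 d2 u1 u2)) (I_ideal K d1 d2 u1 u2)) :
  let q := minn (d1 %/ gcdn d1 u1) (d2 %/ gcdn d2 u2) in
  exists j : nat,
    [/\ 1 <= j <= q,
        stopped (run K d1 d2 u1 u2 j),
        minimal_binomial_generating_set
          (in_seq (output (run K d1 d2 u1 u2 j))) (rees_ideal K d1 d2 u1 u2)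
      & forall H : {mpoly K[5]} -> Prop,
          minimal_binomial_generating_set H (rees_ideal K d1 d2 u1 u2) ->
          equal_up_to_signs H (in_seq (output (run K d1 d2 u1 u2 j)))].
Proof.
have [h1 h2] := exponents_bounds gens_distinct gens_minimal.
have [/andP[u1_gt0 u1_lt] /andP[u2_gt0 u2_lt]] := (h1, h2).
have [j [jq [stop [s [outE ind compl]]]]] := run_finishes K u1_gt0 u1_lt u2_gt0 u2_lt.
exists j; rewrite outE; set A := in_seq _.
have A_pair p q : in_list s p q -> A (pair_binomial K d1 d2 u1 u2 p q).
  by move=> pq; apply/mapP; exists (p, q).
have A_inv f : A f -> exists p q,
    [/\ f = pair_binomial K d1 d2 u1 u2 p q, indispensable u1 d1 u2 d2 p q & 0 < p + q].
  by case/mapP=> -[p q] /= /ind ipq ->; exists p, q; case: (ipq).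
have genA : generates A (rees_ideal K d1 d2 u1 u2).
  move=> f; split; first exact: complete_pairs_generate compl A_pair _.
  move=> [n [c [g [Ag ->]]]]; rewrite /rees_ideal phi_sum big1 // => i _.
  have [p [q [-> _ _]]] := A_inv _ (Ag i).
  by rewrite phiM rees_pair_binomial mulr0.
have pmA f : A f -> pm_binomial f.
  by move=> /A_inv[p [q [-> _ pq0]]]; apply: pair_binomial_pm.
split=> //.
  split=> //; split=> // B BA genB f Af; have [p [q [fE ipq pq0]]] := A_inv _ Af.
  have := indispensable_generator genB (fun f Bf => pmA f (BA f Bf)) ipq.
  rewrite fE => -[//|Bf]; have [p' [q' [fE' _ pq0']]] := A_inv _ (BA _ Bf).
  have e : pair_binomial K d1 d2 u1 u2 p' q' = (- pair_binomial K d1 d2 u1 u2 p q)%R by [].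
  by case: (pair_binomial_neg pq0' pq0 e) => <- <-; rewrite -fE'.
move=> H [[genH minH] pmH] f.
have AH g : A g -> H g \/ H (- g)%R.
  by move=> /A_inv[p [q [-> ipq _]]]; apply: indispensable_generator.
have HA g : H g -> A g \/ A (- g)%R.
  (* The elements of H that belong to A up to sign generate already. *)
  move=> Hg; suff : H g /\ (A g \/ A (- g)%R) by case.
  apply: (minH (fun g => H g /\ (A g \/ A (- g)%R))) Hg => [h []//|h].
  split; last first.
    by move=> Hh; apply/genH/(ideal_of_trans _ Hh) => a [Ha _]; apply: ideal_of_gen.
  move/genA; apply: ideal_of_trans => a Aa; have [Ha|Ha] := AH a Aa.
    by apply: ideal_of_gen; split=> //; left.
  rewrite -[a]opprK; apply/ideal_ofN/ideal_of_gen; split=> //.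
  by right; rewrite opprK.
split=> -[Hf|Hf].
- exact: HA.
- by have := HA _ Hf; rewrite opprK; tauto.
- exact: AH.
by have := AH _ Hf; rewrite opprK; tauto.
Qed.
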